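(* Consider marriage markets $(W,M,\succ_W,\succ_M)$ with full preference lists and $|W|=|M|=n$. Any randomized (or deterministic) algorithm that accesses the input only through Boolean queries, each of which is an arbitrary Boolean function either of the women's profile $\succ_W$ alone or of the men's profile $\succ_M$ alone, requires $\Omega(n^2)$ queries in the worst case to solve any of the following problems: (a) finding a $(1-\varepsilon)$-stable marriage, for fixed $\varepsilon$ with $0\le\varepsilon<\tfrac12$; (b) determining, for a given perfect marriage $\mu$ promised to be either stable or $\varepsilon$-unstable, which is the case, for fixed $\varepsilon$ with $0\le\varepsilon<1$; (c) determining whether a given pair $(w,m)\in W\times M$ is contained in some (respectively, every) stable marriage; (d) finding any $\varepsilon n$ pairs that appear in some (respectively, every) stable marriage, for fixed $\varepsilon$ with $0<\varepsilon\le1$.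
   Context: In a marriage market with full preference lists, $W$ and $M$ are disjoint sets of size $n$, each woman has a total order on $M$ and each man a total order on $W$. A perfect marriage is a bijection between $W$ and $M$, identified with its set of $n$ pairs. A pair $(w,m)$ is blocking for $\mu$ if $w$ prefers $m$ to her spouse in $\mu$ and $m$ prefers $w$ to his spouse in $\mu$; $\mu$ is stable if it has no blocking pair. The divorce distance is $d(\mu,\mu')=n-|\mu\cap\mu'|$, $d(\mu)=\min_{\mu'}d(\mu,\mu')$ over stable perfect marriages $\mu'$; $\mu$ is $(1-\varepsilon)$-stable if $d(\mu)\le\varepsilon n$ and $\varepsilon$-unstable if $d(\mu)>\varepsilon n$. A randomized algorithm must produce a correct output with probability at least $2/3$ on every input; the query count is measured in the worst case over inputs, asymptotically in $n$. *)

(* Defs.v *)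
From HB Require Import structures.
From mathcomp Require Import all_boot all_order all_algebra all_fingroup.
Set Implicit Arguments. Unset Strict Implicit. Unset Printing Implicit Defensive.
Import Order.TTheory GRing.Theory Num.Theory.
Local Open Scope ring_scope.

(* Agents: women W = 'I_n, men M = 'I_n.
   A preference profile of one side assigns to each agent a permutation
   giving the rank of every agent of the other side (rank 0 = best);
   being a bijection, this is exactly a total (strict) order. *)
Definition profile (n : nat) := {ffun 'I_n -> {perm 'I_n}}.

(* a perfect marriage: woman w is married to man (mu w) *)
Definition marriage (n : nat) := {perm 'I_n}.

Section Market.
Variable n : nat.
Variables (pW pM : profile n).

Definition prefW (w m m' : 'I_n) : bool := (pW w m < pW w m')%N.
Definition prefM (m w w' : 'I_n) : bool := (pM m w < pM m w')%N.

Definition blocking (mu : marriage n) (w m : 'I_n) : bool :=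
  prefW w m (mu w) && prefM m w ((mu^-1)%g m).

Definition stable (mu : marriage n) : bool :=
  [forall w, forall m, ~~ blocking mu w m].

Definition in_some (p : 'I_n * 'I_n) : bool :=
  [exists mu : marriage n, stable mu && (mu p.1 == p.2)].
Definition in_every (p : 'I_n * 'I_n) : bool :=
  [forall mu : marriage n, stable mu ==> (mu p.1 == p.2)].
End Market.

Definition ddist n (mu mu' : marriage n) : nat :=
  (n - #|[set w : 'I_n | mu w == mu' w]|)%N.

Section Eps.
Variable R : realFieldType.
Variable eps : R.
Variable n : nat.
Variables (pW pM : profile n).
(* d(mu) <= eps n, d(mu) = min over stable mu' of ddist mu mu' *)
Definition almost_stable (mu : marriage n) : bool :=
  [exists mu' : marriage n, stable pW pM mu' && ((ddist mu mu')%:R <= eps * n%:R)].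
Definition eps_unstable (mu : marriage n) : bool :=
  [forall mu' : marriage n, stable pW pM mu' ==> (eps * n%:R < (ddist mu mu')%:R)].
End Eps.

(* Query algorithms: decision trees, each internal node being an arbitrary
   Boolean function of the women's profile alone or of the men's profile alone. *)
Inductive qtree (n : nat) (O : Type) : Type :=
  | Leaf of O
  | QW of (profile n -> bool) & qtree n O & qtree n O
  | QM of (profile n -> bool) & qtree n O & qtree n O.
Arguments Leaf {n O}.
Arguments QW {n O}.
Arguments QM {n O}.

Fixpoint run n O (t : qtree n O) (pW pM : profile n) : O :=
  match t with
  | Leaf o => o
  | QW f t0 t1 => if f pW then run t1 pW pM else run t0 pW pM
  | QM f t0 t1 => if f pM then run t1 pW pM else run t0 pW pM
  end.

Fixpoint queries n O (t : qtree n O) (pW pM : profile n) : nat :=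
  match t with
  | Leaf _ => 0
  | QW f t0 t1 => (if f pW then queries t1 pW pM else queries t0 pW pM).+1
  | QM f t0 t1 => (if f pM then queries t1 pW pM else queries t0 pW pM).+1
  end.

(* A randomized algorithm: a finitely supported probability distribution over
   deterministic query trees (weights in an ordered field R). *)
Definition is_dist (R : realFieldType) n O (A : seq (R * qtree n O)) : bool :=
  all (fun p => 0 <= p.1) A && (\sum_(p <- A) p.1 == 1).

Definition prob (R : realFieldType) n O (A : seq (R * qtree n O))
  (E : qtree n O -> bool) : R :=
  \sum_(p <- A) (if E p.2 then p.1 else 0).

(* A problem family: for each n, an extra input type I n (e.g. a marriage or a
   pair, known to the algorithm), an output type O n, a promise, and a validity
   relation.  [LowerBoundN2] says: Omega(n^2) queries are needed in the worst case
   by any randomized algorithm that is correct with probability >= 2/3 on every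
   input satisfying the promise. *)
Definition LowerBoundN2 (R : realFieldType) (I O : nat -> Type)
  (promise : forall n, I n -> profile n -> profile n -> bool)
  (valid : forall n, I n -> profile n -> profile n -> O n -> bool) : Prop :=
  exists c : R, 0 < c /\ exists N : nat, forall n : nat, (N <= n)%N ->
    forall A : I n -> seq (R * qtree n (O n)),
      (forall i, is_dist (A i)) ->
      (forall i pW pM, promise n i pW pM ->
         2%:R / 3%:R <= prob (A i) (fun t => valid n i pW pM (run t pW pM))) ->
      exists i pW pM,
        has (fun p => (0 < p.1) && (c * (n ^ 2)%:R <= (queries p.2 pW pM)%:R)) (A i).

Definition Pair n := ('I_n * 'I_n)%type.
Definition PairSet n := {set 'I_n * 'I_n}.
Definition UnitI (n : nat) := unit.
Arguments LowerBoundN2 : clear implicits.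

(* Main.v *)
Require Import Defs.
From HB Require Import structures.
From mathcomp Require Import all_boot all_order all_algebra all_fingroup.
From mathcomp Require Import zify ring lra.
Import Order.TTheory GRing.Theory Num.Theory.
Local Open Scope ring_scope.
Set Implicit Arguments.
Unset Strict Implicit.
Unset Printing Implicit Defensive.

(** All the problems contain unique set disjointness on a grid of L^2 points.
    Women [i] ([i < L]) and men [L + j] carry the two sets: woman [i] ranks first
    the men [L + j] with [(i, j) \in x], man [L + j] ranks first the women [i] with
    [(i, j) \in y], and each falls back on the partner of the same index, whose
    first choice he or she is.  If [x] and [y] are disjoint the identity is the
    only stable marriage.  If they meet in the single point [(i, j)], woman [i]
    and man [L + j] marry, the partner that [i] leaves proposes to woman [2 L],
    and every man from [2 L] on is pushed to the next woman: the only stable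
    marriage is then a long cycle, fixing at most [2 L - 2] women.

    The randomized lower bound for unique disjointness is Razborov's corruption
    argument.  Draw [z] uniformly, then [x] inside [z] and [y] inside its
    complement.  A rectangle [S * T] that is not exponentially small is balanced
    in most coordinates [i], that is, about as many members of [S] (of [T])
    below [z] contain [i] as avoid it; hence it contains almost as large a share
    of the pairs meeting exactly in [i] as of the disjoint pairs.  As this share
    exceeds 1/2, error 1/3 is excluded without amplification. *)

(** * Unique disjointness *)

(** Bernoulli's inequality centred at [a] and valid on both sides of it. It is a discrete tangent
    line to a convex exponential and later plays the part of Jensen's inequality. *)
Lemma exp_tangent (R : realFieldType) (t : R) (n a : nat) : 0 <= t ->
  (1 + t) ^+ a * (1 + t * (n%:R - a%:R)) <= (1 + t) ^+ n.
Proof.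
move=> t0; have t1 : 0 <= 1 + t by lra.
elim: n a => [|n IHn] [|a].
- by rewrite !expr0 subrr mulr0 addr0 mulr1.
- elim: a.+1 => [|b IHb]; first by rewrite !expr0 subrr mulr0 addr0 mulr1.
  apply: le_trans IHb; rewrite exprSr -mulrA ler_wpM2l ?exprn_ge0 // -natr1.
  have b0 : 0 <= b%:R :> R by [].
  nra.
- have := IHn 0%N; rewrite !expr0 !mul1r subr0 => IH; rewrite exprS subr0 -natr1.
  apply: le_trans (ler_wpM2l t1 IH).
  have n0 : 0 <= n%:R :> R by [].
  nra.
- rewrite !exprS -mulrA ler_wpM2l // -!natr1.
  by have -> : n%:R + 1 - (a%:R + 1) = n%:R - a%:R :> R by ring.
Qed.

Lemma subset_of_card (T : finType) (A : {set T}) (n : nat) :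
  (n <= #|A|)%N -> exists2 B : {set T}, B \subset A & #|B| = n.
Proof.
move=> nA; exists [set x in take n (enum A)].
  by apply/subsetP => x; rewrite inE => /mem_take; rewrite mem_enum.
rewrite cardsE (card_uniqP _) ?take_uniq ?enum_uniq // size_take -cardE.
by case: ltngtP nA.
Qed.

Lemma card_set_type (T : finType) : #|{set T}| = (2 ^ #|T|)%N.
Proof. by rewrite -!cardsT -powersetT card_powerset. Qed.

Section UniqueDisjointness.
Variable K : finType.
Implicit Types (S T : {set {set K}}) (x y z : {set K}) (i : K) (c d : nat).

Definition below S z : nat := #|[set x in S | x \subset z]|.
Definition through S i z : nat := #|[set x in S | (i \in x) && (x \subset z)]|.

Lemma belowD1 S i z : (below S z = through S i z + below S (z :\ i))%N.
Proof.
rewrite /below /through -(cardsID [set x : {set K} | i \in x] [set x in S | _]).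
congr (_ + _)%N; apply: eq_card => x; rewrite !inE.
  by rewrite -andbA (andbC (i \in x)).
by rewrite subsetD1; case: (i \in x); rewrite /= ?andbF ?andbT.
Qed.

Lemma below_le S z : (below S z <= 2 ^ #|z|)%N.
Proof.
by rewrite -card_powerset; apply/subset_leq_card/subsetP => x; rewrite !inE => /andP[].
Qed.

Lemma below_setT z : below setT z = (2 ^ #|z|)%N.
Proof. by rewrite -card_powerset; apply: eq_card => x; rewrite !inE. Qed.

(** [below S (z :\ i)] counts the members below [z] that avoid [i]. The ratios are compared after
    clearing denominators, so every [i] counts as balanced when no member of [S] lies below [z]. *)
Definition unbalanced S z : {set K} :=
  [set i in z | ~~ ((3 * below S (z :\ i) <= 4 * through S i z)
                 && (3 * through S i z <= 4 * below S (z :\ i)))%N].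

(* An exponential moment argument: on the members of [S] below [z] the average
   number of coordinates of [B] agreeing with the majority is at least
   [4/7 * #|B|], whereas weighting each agreement by [4/3] multiplies the size
   of the whole cube by only [7/6] per coordinate. *)
Lemma unbalanced_density S z c :
  (70 * c <= #|unbalanced S z|)%N -> (below S z * 2 ^ c <= 2 ^ #|z|)%N.
Proof.
have [R] : inhabited realFieldType by exists; exact: rat.
case/subset_of_card => B /subsetP BU cardB.
pose sg i := (below S (z :\ i) < through S i z)%N.
pose V := [set x in S | x \subset z].
pose N x := #|[set i in B | (i \in x) == sg i]|.
have agree i : i \in B -> (4 * #|V| <= 7 * #|[set x in V | (i \in x) == sg i]|)%N.
  move/BU; rewrite !inE => /andP[iz].
  have -> : #|V| = below S z by [].
  rewrite (belowD1 S i z).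
  have -> : #|[set x in V | (i \in x) == sg i]|
      = if sg i then through S i z else below S (z :\ i).
    rewrite /through /below; case: (sg i); apply: eq_card => x; rewrite !inE.
      by rewrite eqb_id -andbA (andbC (i \in x)).
    by rewrite eqbF_neg -andbA subsetD1.
  rewrite /sg; case: ltnP; lia.
have sumN : (40 * c * #|V| <= \sum_(x in V) N x)%N.
  have -> : (\sum_(x in V) N x = \sum_(i in B) #|[set x in V | (i \in x) == sg i]|)%N.
    under eq_bigr => x _ do rewrite /N -sum1dep_card big_mkcondr /=.
    rewrite exchange_big; apply: eq_bigr => i _.
    by rewrite -sum1dep_card [RHS]big_mkcondr.
  have : (\sum_(i in B) 4 * #|V|
       <= \sum_(i in B) 7 * #|[set x in V | (i \in x) == sg i]|)%N.
    by apply: leq_sum.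
  rewrite sum_nat_const cardB -big_distrr /=.
  lia.
pose l : R := 1 + 1 / 3.
have low : #|V|%:R * l ^+ (40 * c) <= \sum_(x in V) l ^+ N x.
  apply: (@le_trans _ _
    (\sum_(x in V) l ^+ (40 * c) * (1 + 1 / 3 * ((N x)%:R - (40 * c)%:R)))).
    rewrite -big_distrr /= [leLHS]mulrC ler_wpM2l ?exprn_ge0 //; first by rewrite /l; lra.
    rewrite big_split /= sumr_const -big_distrr /= big_split /= sumr_const.
    rewrite -natr_sum mulNrn -mulrnA.
    by move: sumN; rewrite -(ler_nat R) => sumN; lra.
  by apply: ler_sum => x _; apply: exp_tangent; lra.
have up : \sum_(x in V) l ^+ N x <= 2 ^+ (#|z| - #|B|) * (7 / 3) ^+ #|B|.
  (* [W] is the factor contributed by one coordinate. [F] vanishes outside [z], so the expanded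
     product over all of [K] keeps only subsets of [z]; its factors are 7/3 on [B], 2 on the rest of
     [z] and 1 elsewhere. *)
  pose W b i : R := if i \in B then (if b == sg i then l else 1) else 1.
  have WN x : l ^+ N x = \prod_i W (i \in x) i.
    rewrite /N -prodr_const big_mkcond /=.
    by apply: eq_bigr => i _; rewrite /W inE; case: (i \in B).
  have W0 b i : 0 <= W b i.
    by rewrite /W /l; case: ifP => // _; case: ifP => // _; lra.
  have Bz i : i \in B -> i \in z by move/BU; rewrite inE => /andP[].
  pose F i := if i \in z then W true i else 0.
  have F0 i : 0 <= F i by rewrite /F; case: ifP.
  have -> : 2 ^+ (#|z| - #|B|) * (7 / 3) ^+ #|B| = \prod_i (F i + W false i).
    have <- : #|z :\: B| = (#|z| - #|B|)%N.
      by rewrite cardsD (setIidPr _) //; apply/subsetP.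
    rewrite -!prodr_const [X in X * _]big_mkcond [X in _ * X]big_mkcond -big_split /=.
    apply: eq_bigr => i _; rewrite /F /W !inE /l.
    case iB: (i \in B); rewrite /= ?(Bz _ iB); first by case: (sg i) => /=; lra.
    by case: (i \in z); lra.
  rewrite bigA_distr [leRHS](bigID (mem V)) /= -[leLHS]addr0 lerD //; last first.
    by apply: sumr_ge0 => x _; apply: prodr_ge0 => i _; case: ifP.
  apply: ler_sum => x; rewrite inE => /andP[_ /subsetP xz].
  rewrite WN le_eqVlt; apply/predU1l/eq_bigr => i _; rewrite /F.
  by case ix: (i \in x) => //; rewrite xz.
(* This says 2 * (7/6)^70 <= (4/3)^40 and explains the constant 70: each block of 70 unbalanced
   coordinates gains a factor 2. *)
have num : 2 * (7 / 3) ^+ 70 <= l ^+ 40 * 2 ^+ 70 by rewrite /l; lra.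
have {}num : 2 ^+ c * (7 / 3) ^+ (70 * c) <= l ^+ (40 * c) * 2 ^+ (70 * c).
  rewrite !exprM -!exprMn lerXn2r // nnegrE mulr_ge0 ?exprn_ge0 //; rewrite /l; lra.
have Bz : (#|B| <= #|z|)%N.
  by apply/subset_leq_card/subsetP => i /BU; rewrite inE => /andP[].
have p0 : 0 < (7 / 3) ^+ (70 * c) :> R by rewrite exprn_gt0 //; lra.
rewrite -(ler_nat R) natrM !natrX -(ler_pM2r p0) -mulrA.
apply: le_trans (ler_wpM2l _ num) _ => //.
rewrite mulrA.
apply: (@le_trans _ _ (2 ^+ (#|z| - #|B|) * (7 / 3) ^+ #|B| * 2 ^+ (70 * c))).
  rewrite ler_wpM2r ?exprn_ge0 //; apply: le_trans low up.
by rewrite mulrAC -cardB -exprD subnK.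
Qed.

Variable R : realFieldType.

(** Unnormalised laws of the hard inputs: [wdisj] for disjoint pairs, of total mass 4^|K|, and
    [wmeet] for pairs meeting in one point, of total mass |K| * 4^|K| / 4. *)
Definition wdisj x y : R := \sum_(z : {set K}) (x \subset z)%:R * (y \subset ~: z)%:R.
Definition wmeet x y : R := \sum_i \sum_(z : {set K} | i \in z)
  ((i \in x) && (x \subset z))%:R * ((i \in y) && (y \subset ~: (z :\ i)))%:R.

Lemma wdisj_ge0 x y : 0 <= wdisj x y.
Proof. by apply: sumr_ge0 => z _; rewrite mulr_ge0. Qed.

Lemma wmeet_ge0 x y : 0 <= wmeet x y.
Proof. by apply: sumr_ge0 => i _; apply: sumr_ge0 => z _; rewrite mulr_ge0. Qed.

Lemma wdisj_support x y : wdisj x y != 0 -> x :&: y = set0.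
Proof.
move=> nz; apply/eqP; rewrite setI_eq0 disjoints_subset; apply/negPn/negP => nxy.
case/eqP: nz; apply: big1 => z _.
case xz: (x \subset z); last by rewrite mul0r.
case yz: (y \subset ~: z); last by rewrite mulr0.
by case/negP: nxy; apply: subset_trans xz _; rewrite subsetC.
Qed.

Lemma wmeet_support x y : wmeet x y != 0 -> exists i, x :&: y = [set i].
Proof.
case: (pickP (fun i => x :&: y == [set i])) => [i /eqP ? _ | none]; first by exists i.
case/eqP; apply: big1 => i _; apply: big1 => z iz; apply/eqP.
rewrite mulf_eq0 !pnatr_eq0 !eqb0 -negb_and; apply/negP.
case/andP => /andP[ix /subsetP xz] /andP[iy /subsetP yz].
case/eqP: (none i); apply/setP => j; rewrite !inE.
apply/andP/eqP => [[jx jy]|-> //].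
by move: (yz _ jy); rewrite !inE xz // andbT negbK => /eqP.
Qed.

Definition bmass S T z : R := (below S z)%:R * (below T (~: z))%:R.

Lemma sum_wdisj S T :
  \sum_(x in S) \sum_(y in T) wdisj x y = \sum_z bmass S T z.
Proof.
under eq_bigr => x _ do rewrite exchange_big.
rewrite exchange_big; apply: eq_bigr => z _.
under eq_bigr => x _ do rewrite -big_distrr /=.
rewrite -big_distrl /= -!natr_sum /bmass /below -!sum1dep_card.
by congr (_%:R * _%:R); rewrite [RHS]big_mkcondr.
Qed.

Lemma sum_wmeet S T :
  \sum_(x in S) \sum_(y in T) wmeet x y = \sum_i \sum_(z : {set K} | i \in z)
     (through S i z)%:R * (through T i (~: (z :\ i)))%:R.
Proof.
under eq_bigr => x _ do rewrite exchange_big.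
rewrite exchange_big; apply: eq_bigr => i _.
under eq_bigr => x _ do rewrite exchange_big.
rewrite exchange_big; apply: eq_bigr => z _.
under eq_bigr => x _ do rewrite -big_distrr /=.
rewrite -big_distrl /= -!natr_sum /through -!sum1dep_card.
by congr (_%:R * _%:R); rewrite [RHS]big_mkcondr.
Qed.

Lemma sum_setD1 i (F : {set K} -> R) :
  \sum_(z : {set K} | i \in z) F (z :\ i) = \sum_(z : {set K} | i \notin z) F z.
Proof.
rewrite (reindex_onto (fun z => i |: z) (fun z => z :\ i)) /=; last exact: setD1K.
apply: eq_big => [z|z /andP[_ /eqP -> //]].
rewrite setU11 /=; apply/eqP/idP => [<-|/setU1K //]; by rewrite setD11.
Qed.

Lemma bmass_ge0 S T z : 0 <= bmass S T z.
Proof. by rewrite /bmass mulr_ge0. Qed.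

(** Double counting of the edges from [z :\ i] to [z] in the cube of subsets: a vertex [z] is the
    upper end for [i] in [z] and the lower end for the other [i]. *)
Lemma sum_flip (F : K -> {set K} -> R) (G : K -> {set K} -> R) :
  \sum_i \sum_(z : {set K} | i \in z) (F i z + G i (z :\ i))
  = \sum_(z : {set K}) (\sum_(i in z) F i z + \sum_(i in ~: z) G i z).
Proof.
under eq_bigr => i _ do rewrite big_split /= sum_setD1.
rewrite !big_split /=; congr (_ + _).
  by rewrite (exchange_big_dep xpredT).
rewrite (exchange_big_dep xpredT) //=; apply: eq_bigr => z _.
by apply: eq_bigl => i; rewrite inE.
Qed.

Lemma sum_bmass_flip S T :
  \sum_i \sum_(z : {set K} | i \in z) (bmass S T z + bmass S T (z :\ i))
  = #|K|%:R * \sum_z bmass S T z.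
Proof.
rewrite (sum_flip (fun _ => bmass S T) (fun _ => bmass S T)) big_distrr /=.
apply: eq_bigr => z _; rewrite !sumr_const -mulrnDr -(cardsC z) mulrC.
by rewrite mulr_natr.
Qed.

(* If [P0, P1, Q0, Q1] are the numbers of members of [S] and [T] avoiding or
   containing [i], then [4 P1 Q1] is compared with the masses of [z] and
   [z :\ i]; an unbalanced side dominates the mass of a balanced one. *)
Lemma four_point (P0 P1 Q0 Q1 : R) (p q : bool) :
  0 <= P0 -> 0 <= P1 -> 0 <= Q0 -> 0 <= Q1 ->
  (~~ p -> 3 * P0 <= 4 * P1 /\ 3 * P1 <= 4 * P0) ->
  (~~ q -> 3 * Q0 <= 4 * Q1 /\ 3 * Q1 <= 4 * Q0) ->
  9 / 14 * ((P1 + P0) * Q0 + P0 * (Q1 + Q0))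
  - 15 / 7 * (p%:R * ((P1 + P0) * Q0) + q%:R * (P0 * (Q1 + Q0)))
  <= 4 * (P1 * Q1).
Proof.
move=> p0 p1 q0 q1; have := mulr_ge0 p1 q1; have := mulr_ge0 p1 q0.
have := mulr_ge0 p0 q1; have := mulr_ge0 p0 q0 => h00 h01 h10 h11.
case: p; case: q => /= hp hq; first by lra.
- by have [] := hq isT; nra.
- by have [] := hp isT; nra.
have [a1 a2] := hp isT; have [b1 b2] := hq isT; nra.
Qed.

(** For each [z], either both sides have fewer than [70 * c] unbalanced coordinates, or
    [unbalanced_density] bounds the mass of [z] by 2^|K| / 2^c. In the latter case the count is at
    most |K|, and there are 2^|K| sets [z]. *)
Lemma unbalanced_mass S T c :
  \sum_z bmass S T z * (#|unbalanced S z| + #|unbalanced T (~: z)|)%:R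
  <= (140 * c)%:R * (\sum_z bmass S T z) + #|K|%:R * (4 ^+ #|K| / 2 ^+ c).
Proof.
have -> : #|K|%:R * (4 ^+ #|K| / 2 ^+ c)
    = \sum_(z : {set K}) #|K|%:R * (2 ^+ #|K| / 2 ^+ c) :> R.
  rewrite sumr_const card_set_type -[RHS]mulr_natr natrX.
  have -> : 4 = 2 * 2 :> R by ring.
  by rewrite exprMn; ring.
rewrite big_distrr -big_split /=; apply: ler_sum => z _.
have m0 := bmass_ge0 S T z; have c0 : 0 < 2 ^+ c :> R by rewrite exprn_gt0.
have uK : (#|unbalanced S z| + #|unbalanced T (~: z)| <= #|K|)%N.
  rewrite -(cardsC z) leq_add //.
    by apply/subset_leq_card/subsetP => i; rewrite inE => /andP[].
  by apply/subset_leq_card/subsetP => i; rewrite inE => /andP[].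
have small (a b : nat) : (a * 2 ^ c <= 2 ^ #|z|)%N && (b <= 2 ^ #|~: z|)%N
   || (a <= 2 ^ #|z|)%N && (b * 2 ^ c <= 2 ^ #|~: z|)%N ->
   a%:R * b%:R <= 2 ^+ #|K| / 2 ^+ c :> R.
  rewrite ler_pdivlMr // -(cardsC z) -natrM -!natrX -natrM ler_nat expnD.
  by case/orP => /andP[/leq_mul h /h]; rewrite ?mulnA // mulnAC.
have k0 : 0 <= #|K|%:R * (2 ^+ #|K| / 2 ^+ c) :> R.
  by rewrite mulr_ge0 ?divr_ge0 ?exprn_ge0.
have [hS|hS] := leqP (70 * c) #|unbalanced S z|.
  rewrite -[leLHS]add0r lerD ?mulr_ge0 // mulrC ler_pM ?ler_nat //.
  by apply: small; rewrite unbalanced_density //= below_le.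
have [hT|hT] := leqP (70 * c) #|unbalanced T (~: z)|.
  rewrite -[leLHS]add0r lerD ?mulr_ge0 // mulrC ler_pM ?ler_nat //.
  by apply: small; rewrite (unbalanced_density hT) !below_le orbT.
by rewrite -[leLHS]addr0 lerD // mulrC ler_wpM2r // ler_nat; lia.
Qed.

(* At most [140 * c <= #|K| / 20] coordinates are unbalanced for a typical [z],
   whence [15 / 28 = 9 / 14 - 15 / 7 * (1 / 20)]. *)
Lemma corruption S T c : (2800 * c <= #|K|)%N ->
  15 / 28 * #|K|%:R * (\sum_(x in S) \sum_(y in T) wdisj x y)
    - 15 / 7 * (#|K|%:R * (4 ^+ #|K| / 2 ^+ c))
  <= 4 * \sum_(x in S) \sum_(y in T) wmeet x y.
Proof.
move=> ck; rewrite sum_wdisj sum_wmeet [leRHS]big_distrr /=.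
under [leRHS]eq_bigr => i _ do rewrite big_distrr /=.
pose bS i z : R := (i \in unbalanced S z)%:R.
pose bT i z : R := (i \in unbalanced T (~: z))%:R.
pose m := bmass S T.
(* The edge from [z :\ i] to [z] is charged for [S] at its upper end and for [T] at its lower end,
   as in [four_point]. Regrouped by vertices, the charges count the unbalanced coordinates of both
   sides. *)
apply: (@le_trans _ _ (\sum_i \sum_(z : {set K} | i \in z)
   (9 / 14 * (m z + m (z :\ i)) - 15 / 7 * (bS i z * m z + bT i (z :\ i) * m (z :\ i))))).
  have -> : \sum_i \sum_(z : {set K} | i \in z)
     (9 / 14 * (m z + m (z :\ i)) - 15 / 7 * (bS i z * m z + bT i (z :\ i) * m (z :\ i)))
    = 9 / 14 * (#|K|%:R * \sum_z m z)
    - 15 / 7 * (\sum_z m z * (#|unbalanced S z| + #|unbalanced T (~: z)|)%:R).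
    rewrite -sum_bmass_flip [X in _ = X - _]big_distrr.
    under [X in _ = X - _]eq_bigr => i _ do rewrite big_distrr /=.
    have -> : \sum_z m z * (#|unbalanced S z| + #|unbalanced T (~: z)|)%:R
       = \sum_i \sum_(z : {set K} | i \in z)
           (bS i z * m z + bT i (z :\ i) * m (z :\ i)).
      rewrite (sum_flip (fun i z => bS i z * m z) (fun i z => bT i z * m z)).
      apply: eq_bigr => z _; rewrite -!big_distrl /= -mulrDl mulrC natrD.
      congr ((_ + _) * _); rewrite -natr_sum -sum1_card; congr _%:R.
        rewrite [RHS]big_mkcond [LHS]big_mkcond; apply: eq_bigr => i _.
        by rewrite inE; case: (i \in z) => //=; case: (~~ _).
      rewrite [RHS]big_mkcond [LHS]big_mkcond; apply: eq_bigr => i _.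
      by rewrite inE; case: (i \in ~: z) => //=; case: (~~ _).
    rewrite [X in _ = _ - X]big_distrr -sumrB /=; apply: eq_bigr => i _.
    by rewrite [X in _ = _ - X]big_distrr -sumrB.
  have := unbalanced_mass S T c; rewrite -/m.
  have : (140 * c)%:R <= #|K|%:R / 20 :> R.
    by rewrite ler_pdivlMr // -natrM ler_nat; lia.
  have : 0 <= \sum_z m z by apply: sumr_ge0 => z _; apply: bmass_ge0.
  nra.
apply: ler_sum => i _; apply: ler_sum => z iz; rewrite /m /bmass.
have zi : (~: (z :\ i)) :\ i = ~: z.
  by apply/setP => j; rewrite !inE; case: eqP => [->|]; rewrite ?iz.
rewrite (belowD1 S i z) (belowD1 T i (~: (z :\ i))) zi !natrD.
apply: four_point => //; rewrite /unbalanced !inE ?iz ?eqxx ?zi /= negbK.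
  by case/andP; rewrite -(ler_nat R) -[X in _ -> is_true X -> _](ler_nat R) !natrM.
by case/andP; rewrite -(ler_nat R) -[X in _ -> is_true X -> _](ler_nat R) !natrM.
Qed.

Lemma total_bmass : \sum_z bmass [set: {set K}] [set: {set K}] z = 4 ^+ #|K| :> R.
Proof.
transitivity (\sum_(z : {set K}) 2 ^+ #|K| : R).
  by apply: eq_bigr => z _; rewrite /bmass !below_setT !natrX -exprD cardsC.
rewrite sumr_const card_set_type -[LHS]mulr_natr natrX -exprMn.
by congr (_ ^+ _); ring.
Qed.

Lemma total_wdisj :
  \sum_(x in [set: {set K}]) \sum_(y in [set: {set K}]) wdisj x y = 4 ^+ #|K| :> R.
Proof. by rewrite sum_wdisj total_bmass. Qed.

(** On the full cube every coordinate is exactly balanced, so four times the mass meeting at [i]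
    equals the mass of the two ends of the edge. *)
Lemma total_wmeet :
  4 * (\sum_(x in [set: {set K}]) \sum_(y in [set: {set K}]) wmeet x y)
  = #|K|%:R * 4 ^+ #|K| :> R.
Proof.
rewrite -total_bmass -sum_bmass_flip sum_wmeet big_distrr /=.
apply: eq_bigr => i _; rewrite big_distrr /=; apply: eq_bigr => z iz.
have throughT (y : {set K}) : i \in y -> through setT i y = (2 ^ #|y :\ i|)%N.
  move=> iy; have := belowD1 setT i y; rewrite !below_setT [#|y|](cardsD1 i) iy expnS.
  by rewrite mul2n -addnn => /addIn.
have iz' : i \in ~: (z :\ i) by rewrite !inE eqxx.
have zi : (~: (z :\ i)) :\ i = ~: z.
  by apply/setP => j; rewrite !inE; case: eqP => [->|]; rewrite ?iz.
rewrite !throughT // /bmass !below_setT zi.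
rewrite [#|z|](cardsD1 i) iz [#|~: (z :\ i)|](cardsD1 i) iz' zi !natrX !exprS.
ring.
Qed.

(** * Corruption along query trees *)

Section Tree.
Variables (n : nat) (O : Type) (eW eM : {set K} -> profile n) (g : O -> bool).

(** A query splits only one side of [S * T], so the inputs reaching a leaf form a rectangle, to
    which [corruption] applies if [g] accepts the leaf. The error is paid once per leaf, at most
    [2 ^ d] times. *)
Lemma tree_corruption (t : qtree n O) c d S T : (2800 * c <= #|K|)%N ->
  (forall x y, x \in S -> y \in T -> (queries t (eW x) (eM y) <= d)%N) ->
  15 / 28 * #|K|%:R * (\sum_(x in S) \sum_(y in T)
                         wdisj x y * (g (run t (eW x) (eM y)))%:R)
    - 2 ^+ d * (15 / 7 * (#|K|%:R * (4 ^+ #|K| / 2 ^+ c)))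
  <= 4 * \sum_(x in S) \sum_(y in T) wmeet x y * (g (run t (eW x) (eM y)))%:R.
Proof.
move=> ck; set tau := 15 / 7 * _.
have tau0 : 0 <= tau.
  by rewrite mulr_ge0 ?divr_ge0 // mulr_ge0 ?divr_ge0 ?exprn_ge0.
elim: t d S T => [o|f t0 IH0 t1 IH1|f t0 IH0 t1 IH1] d S T hq /=.
- have d1 : tau <= 2 ^+ d * tau by rewrite ler_peMl // exprn_ege1 // ler1n.
  case: (g o).
    under eq_bigr => x _ do under eq_bigr => y _ do rewrite mulr1.
    under [in leRHS]eq_bigr => x _ do under eq_bigr => y _ do rewrite mulr1.
    apply: le_trans (corruption S T ck).
    by rewrite -/tau lerD2l lerN2.
  under eq_bigr => x _ do under eq_bigr => y _ do rewrite mulr0.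
  under [in leRHS]eq_bigr => x _ do under eq_bigr => y _ do rewrite mulr0.
  rewrite big1 => [|x _]; last by rewrite big1.
  by rewrite !mulr0 sub0r oppr_le0; apply: le_trans d1.
- case: d hq => [|d] hq.
    (* With no query left in the budget, [hq] forces the rectangle to be empty. *)
    rewrite big1 => [|x xS]; last by rewrite big1 // => y yT; have := hq _ _ xS yT.
    rewrite big1 => [|x xS]; last by rewrite big1 // => y yT; have := hq _ _ xS yT.
    by rewrite !mulr0 sub0r oppr_le0 expr0 mul1r.
  pose S1 := [set x | f (eW x)].
  have q1 x y : x \in S :&: S1 -> y \in T -> (queries t1 (eW x) (eM y) <= d)%N.
    by rewrite !inE => /andP[xS fx] yT; have := hq x y xS yT; rewrite /= fx.
  have q0 x y : x \in S :\: S1 -> y \in T -> (queries t0 (eW x) (eM y) <= d)%N.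
    by rewrite !inE => /andP[fx xS] yT; have := hq x y xS yT; rewrite /= (negbTE fx).
  have split (w : {set K} -> {set K} -> R) :
      \sum_(x in S) \sum_(y in T) w x y
         * (g (if f (eW x) then run t1 (eW x) (eM y) else run t0 (eW x) (eM y)))%:R
    = \sum_(x in S :&: S1) \sum_(y in T) w x y * (g (run t1 (eW x) (eM y)))%:R
    + \sum_(x in S :\: S1) \sum_(y in T) w x y * (g (run t0 (eW x) (eM y)))%:R.
    rewrite (big_setID S1) /=; congr (_ + _); apply: eq_bigr => x; rewrite !inE.
      by case/andP=> _ ->.
    by case/andP=> /negbTE -> _.
  have := lerD (IH1 d _ _ q1) (IH0 d _ _ q0).
  by rewrite !split exprS; lra.
- case: d hq => [|d] hq.
    rewrite big1 => [|x xS]; last by rewrite big1 // => y yT; have := hq _ _ xS yT.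
    rewrite big1 => [|x xS]; last by rewrite big1 // => y yT; have := hq _ _ xS yT.
    by rewrite !mulr0 sub0r oppr_le0 expr0 mul1r.
  pose T1 := [set y | f (eM y)].
  have q1 x y : x \in S -> y \in T :&: T1 -> (queries t1 (eW x) (eM y) <= d)%N.
    by rewrite !inE => xS /andP[yT fy]; have := hq x y xS yT; rewrite /= fy.
  have q0 x y : x \in S -> y \in T :\: T1 -> (queries t0 (eW x) (eM y) <= d)%N.
    by rewrite !inE => xS /andP[fy yT]; have := hq x y xS yT; rewrite /= (negbTE fy).
  have split (w : {set K} -> {set K} -> R) :
      \sum_(x in S) \sum_(y in T) w x y
         * (g (if f (eM y) then run t1 (eW x) (eM y) else run t0 (eW x) (eM y)))%:R
    = \sum_(x in S) \sum_(y in T :&: T1) w x y * (g (run t1 (eW x) (eM y)))%:R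
    + \sum_(x in S) \sum_(y in T :\: T1) w x y * (g (run t0 (eW x) (eM y)))%:R.
    rewrite -big_split; apply: eq_bigr => x _.
    rewrite (big_setID T1) /=; congr (_ + _); apply: eq_bigr => y; rewrite !inE.
      by case/andP=> _ ->.
    by case/andP=> /negbTE -> _.
  have := lerD (IH1 d _ _ q1) (IH0 d _ _ q0).
  by rewrite !split exprS; lra.
Qed.

Lemma randomized_corruption (A : seq (R * qtree n O)) c d :
  (2800 * c <= #|K|)%N -> is_dist A ->
  (forall x y, ~~ has (fun p => (0 < p.1) && (d < queries p.2 (eW x) (eM y))%N) A) ->
  15 / 28 * #|K|%:R * (\sum_(x in [set: {set K}]) \sum_(y in [set: {set K}])
                         wdisj x y * prob A (fun t => g (run t (eW x) (eM y))))
    - 2 ^+ d * (15 / 7 * (#|K|%:R * (4 ^+ #|K| / 2 ^+ c)))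
  <= 4 * \sum_(x in [set: {set K}]) \sum_(y in [set: {set K}])
           wmeet x y * prob A (fun t => g (run t (eW x) (eM y))).
Proof.
move=> ck /andP[A0 /eqP A1] hq.
set tau := 2 ^+ d * _.
(* Weighted by the total mass, the inequality is additive over [A]; this allows induction on the
   list, whose tails are not distributions. *)
have -> : tau = (\sum_(p <- A) p.1) * tau by rewrite A1 mul1r.
rewrite /prob {A1}.
elim: A A0 hq => [_ _|[a t] A IH /= /andP[a0 A0] hq].
  rewrite !big_nil big1 => [|x _]; last by rewrite big1 // => y _; rewrite big_nil mulr0.
  rewrite big1 => [|x _]; last by rewrite big1 // => y _; rewrite big_nil mulr0.
  by rewrite !mulr0 mul0r subr0.
have hqA x y : ~~ has (fun p => (0 < p.1) && (d < queries p.2 (eW x) (eM y))%N) A.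
  by move: (hq x y); rewrite negb_or => /andP[].
have {}IH := IH A0 hqA.
have split (w : {set K} -> {set K} -> R) :
   \sum_(x in [set: {set K}]) \sum_(y in [set: {set K}]) w x y *
      (\sum_(p <- (a, t) :: A) (if g (run p.2 (eW x) (eM y)) then p.1 else 0))
   = a * (\sum_(x in [set: {set K}]) \sum_(y in [set: {set K}])
            w x y * (g (run t (eW x) (eM y)))%:R)
   + \sum_(x in [set: {set K}]) \sum_(y in [set: {set K}]) w x y *
      (\sum_(p <- A) (if g (run p.2 (eW x) (eM y)) then p.1 else 0)).
  rewrite big_distrr -big_split; apply: eq_bigr => x _.
  rewrite big_distrr -big_split; apply: eq_bigr => y _ /=.
  by rewrite big_cons mulrDr /=; case: (g _); rewrite /= ?mulr1 ?mulr0 // mulrC.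
rewrite !split big_cons /=.
have [a00|apos] := eqVneq a 0; first by rewrite a00 !mul0r !add0r.
have {}apos : 0 < a by rewrite lt_def apos.
have := @tree_corruption t c d setT setT ck.
have qd x y : x \in [set: {set K}] -> y \in [set: {set K}] ->
    (queries t (eW x) (eM y) <= d)%N.
  by move=> _ _; move: (hq x y); rewrite apos negb_or -leqNgt => /andP[].
move=> /(_ qd); rewrite -(ler_pM2l apos) -/tau => h.
have := lerD h IH; lra.
Qed.

(** The main term 15/28 * 2/3 = 5/14 exceeds 1/3 by 1/42. If [c] were at least [d + 7], the error
    term would be at most 15/7 * 1/128, which is less than 1/42. *)
Lemma unique_disjointness_bound (A : seq (R * qtree n O)) c d :
  (0 < #|K|)%N -> (2800 * c <= #|K|)%N -> is_dist A ->
  (forall x y, ~~ has (fun p => (0 < p.1) && (d < queries p.2 (eW x) (eM y))%N) A) ->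
  (forall x y, x :&: y = set0 ->
     2 / 3 <= prob A (fun t => g (run t (eW x) (eM y)))) ->
  (forall x y i, x :&: y = [set i] ->
     prob A (fun t => g (run t (eW x) (eM y))) <= 1 / 3) ->
  (c < d + 7)%N.
Proof.
move=> k0 ck dA hq h0 h1; rewrite ltnNge; apply/negP => dc.
have := randomized_corruption ck dA hq.
set X := \sum_(x in _) _; set Y := \sum_(x in _) _.
have hX : 2 / 3 * 4 ^+ #|K| <= X.
  rewrite -total_wdisj big_distrr /=; apply: ler_sum => x _.
  rewrite big_distrr /=; apply: ler_sum => y _; rewrite mulrC.
  have [->|/wdisj_support/h0 h] := eqVneq (wdisj x y) 0; first by rewrite !mul0r.
  by rewrite ler_wpM2l ?wdisj_ge0.
have hY : 4 * Y <= 1 / 3 * (#|K|%:R * 4 ^+ #|K|).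
  rewrite -total_wmeet mulrCA ler_wpM2l // big_distrr /=; apply: ler_sum => x _.
  rewrite big_distrr /=; apply: ler_sum => y _; rewrite [leRHS]mulrC.
  have [->|/wmeet_support[i /h1 h]] := eqVneq (wmeet x y) 0; first by rewrite !mul0r.
  by rewrite ler_wpM2l ?wmeet_ge0.
have p0 : 0 < #|K|%:R * 4 ^+ #|K| :> R by rewrite mulr_gt0 ?ltr0n ?exprn_gt0.
have e : 2 ^+ d / 2 ^+ c <= 1 / 128 :> R.
  rewrite ler_pdivrMr ?exprn_gt0 // -(subnK dc) addnC -addnA exprD.
  have : 1 <= 2 ^+ (c - (d + 7)) :> R by rewrite exprn_ege1 // ler1n.
  have : 0 < 2 ^+ d :> R by rewrite exprn_gt0.
  rewrite addnC exprD; set u := 2 ^+ d; set v := 2 ^+ (c - _).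
  nra.
have -> : 2 ^+ d * (15 / 7 * (#|K|%:R * (4 ^+ #|K| / 2 ^+ c)))
   = 15 / 7 * (2 ^+ d / 2 ^+ c) * (#|K|%:R * 4 ^+ #|K|) :> R by ring.
have := ler_wpM2r (ltW p0) e.
have := ler_wpM2l (ler0n R #|K|) hX.
lra.
Qed.
End Tree.
End UniqueDisjointness.

(** * The market *)

Definition unique_stable n (pW pM : profile n) (mu : marriage n) : Prop :=
  forall nu : marriage n, stable pW pM nu = (nu == mu).

(* Each couple consists of mutual favourites among the couples of no smaller
   rank, up to agents who are guaranteed a better spouse because they are the
   first choice of that spouse. *)
Lemma unique_stable_ranked n (pW pM : profile n) (mu : marriage n) (rho : 'I_n -> nat) :
  (forall w m, prefW pW w m (mu w) ->
     (rho ((mu^-1)%g m) < rho w)%N \/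
     prefM pM m ((mu^-1)%g m) w /\
     forall m', m' != m -> prefW pW ((mu^-1)%g m) m m') ->
  (forall m w, prefM pM m w ((mu^-1)%g m) ->
     (rho w < rho ((mu^-1)%g m))%N \/
     prefW pW w (mu w) m /\ forall w', w' != w -> prefM pM (mu w) w w') ->
  unique_stable pW pM mu.
Proof.
move=> hW hM nu; apply/idP/eqP => [st|->]; last first.
  apply/forallP => w; apply/forallP => m; apply/negP => /andP[bw bm].
  (* A pair blocking [mu] contradicts the second alternative of each hypothesis, and the two first
     alternatives contradict each other. *)
  have [lt1|[+ _]] := hW _ _ bw; last by move: bm; rewrite /prefM; lia.
  have [lt2|[+ _]] := hM _ _ bm; first by lia.
  by move: bw; rewrite /prefW; lia.
have nobl w m : prefW pW w m (nu w) -> prefM pM m w ((nu^-1)%g m) -> False.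
  move=> bw bm; move/forallP: st => /(_ w) /forallP /(_ m).
  by rewrite /blocking bw bm.
(* Induction on the rank: couples of smaller rank already agree in [nu] and [mu]. *)
apply/permP => w; have [k] := ubnP (rho w); elim: k w => // k IH w rw.
have {}IH v : (rho v < rho w)%N -> nu v = mu v by move=> h; apply: IH; lia.
apply/eqP/negPn/negP => ne.
have prefWtot v m m' : m != m' -> prefW pW v m m' || prefW pW v m' m.
  by rewrite /prefW -neq_ltn (inj_eq val_inj) (inj_eq perm_inj).
have prefMtot v m m' : m != m' -> prefM pM v m m' || prefM pM v m' m.
  by rewrite /prefM -neq_ltn (inj_eq val_inj) (inj_eq perm_inj).
case/orP: (prefWtot w _ _ ne) => [pw|pw].
  have [lt|[pm top]] := hW _ _ pw.
    have /perm_inj e : nu ((mu^-1)%g (nu w)) = nu w by rewrite IH // permKV.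
    by move: lt; rewrite e ltnn.
  (* The [mu]-wife of [nu w] has him as first choice and he prefers her to [w], so the two would
     block [nu]. *)
  have nw : (mu^-1)%g (nu w) != w by rewrite (can2_eq (permKV mu) (permK mu)).
  apply: (nobl ((mu^-1)%g (nu w)) (nu w)); last by rewrite permK.
  by apply: top; rewrite (inj_eq perm_inj).
have nm : (nu^-1)%g (mu w) != w by rewrite (can2_eq (permKV nu) (permK nu)) eq_sym.
case/orP: (prefMtot (mu w) _ _ nm) => [pm|pm]; last exact: nobl pw pm.
have := hM (mu w) ((nu^-1)%g (mu w)); rewrite permK => /(_ pm) [lt|[pv top]].
  have := IH _ lt; rewrite permKV => /perm_inj e.
  by move/eqP: nm; rewrite -e.
apply: (nobl ((nu^-1)%g (mu w)) (mu ((nu^-1)%g (mu w)))).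
  by rewrite permKV.
by apply: top; rewrite !(inj_eq perm_inj).
Qed.

(** * Preference orders from integer scores *)

Section RankPerm.
Variables (n : nat) (f : 'I_n -> nat).

(** Lexicographic key: the score first, then the index, so that tied agents still receive distinct
    ranks. *)
Let key (a : 'I_n) := (f a * n + a)%N.

Let key_inj : injective key.
Proof.
move=> a b e; apply/val_inj => /=.
by have := congr1 (modn^~ n) e; rewrite /key !modnMDl !modn_small.
Qed.

Let rank_subproof a : (#|[set b | (key b < key a)%N]| < n)%N.
Proof.
rewrite -[X in (_ < X)%N]card_ord -cardsT; apply: proper_card.
by apply/properP; split; [apply: subsetT | exists a; rewrite ?inE ?ltnn].
Qed.

Let rank a := Ordinal (rank_subproof a).

Let rank_lt a b : (key a < key b)%N -> (rank a < rank b)%N.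
Proof.
move=> ab; apply: proper_card; apply/properP; split; last by exists a; rewrite !inE ?ltnn.
by apply/subsetP => x; rewrite !inE => /ltn_trans; apply.
Qed.

Let rank_inj : injective rank.
Proof.
move=> a b e; apply: key_inj; case: (ltngtP (key a) (key b)) => // /rank_lt.
  by rewrite e ltnn.
by rewrite e ltnn.
Qed.

Definition rank_perm : {perm 'I_n} := perm rank_inj.

Lemma rank_perm_lt a b : (f a < f b)%N -> (rank_perm a < rank_perm b)%N.
Proof.
move=> ab; rewrite !permE; apply: rank_lt; rewrite /key.
by have := ltn_ord a; nia.
Qed.

Lemma rank_perm_le a b : (rank_perm a < rank_perm b)%N -> (f a <= f b)%N.
Proof. by apply: contraTT; rewrite -!leqNgt -ltnNge => /rank_perm_lt /ltnW. Qed.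
End RankPerm.

Definition score_profile n (s : nat -> nat -> nat) : profile n :=
  [ffun a : 'I_n => rank_perm (fun b : 'I_n => s a b)].

Lemma nat_perm n (f g : nat -> nat) :
  (forall a, (a < n)%N -> [/\ (f a < n)%N, (g a < n)%N, g (f a) = a & f (g a) = a]) ->
  exists mu : {perm 'I_n}, forall a : 'I_n, mu a = f a :> nat /\ (mu^-1)%g a = g a :> nat.
Proof.
move=> h.
have fP (a : 'I_n) : (f a < n)%N by have [] := h a (ltn_ord a).
have gP (a : 'I_n) : (g a < n)%N by have [] := h a (ltn_ord a).
have fK : cancel (fun a => Ordinal (fP a)) (fun a => Ordinal (gP a)).
  by move=> a; apply: val_inj => /=; have [] := h a (ltn_ord a).
exists (perm (can_inj fK)) => a; split; first by rewrite permE.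
have -> : a = perm (can_inj fK) (Ordinal (gP a)).
  by apply: val_inj; rewrite permE /=; have [] := h a (ltn_ord a).
by rewrite permK permE /=; have [_ _ _ ->] := h a (ltn_ord a).
Qed.

(** A tie may be broken either way: candidates for a better spouse are therefore taken with a weak
    score inequality, while the preferences to be exhibited must be strict in score. *)
Lemma unique_stable_score n (sW sM : nat -> nat -> nat) (f g rho : nat -> nat) :
  (forall a, (a < n)%N -> [/\ (f a < n)%N, (g a < n)%N, g (f a) = a & f (g a) = a]) ->
  (forall w m, (w < n)%N -> (m < n)%N -> m <> f w -> (sW w m <= sW w (f w))%N ->
     (rho (g m) < rho w)%N \/
     (sM m (g m) < sM m w)%N /\
     forall m', (m' < n)%N -> m' <> m -> (sW (g m) m < sW (g m) m')%N) ->
  (forall m w, (m < n)%N -> (w < n)%N -> w <> g m -> (sM m w <= sM m (g m))%N ->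
     (rho w < rho (g m))%N \/
     (sW w (f w) < sW w m)%N /\
     forall w', (w' < n)%N -> w' <> w -> (sM (f w) w < sM (f w) w')%N) ->
  exists2 mu : marriage n, forall w : 'I_n, mu w = f w :> nat &
    unique_stable (score_profile n sW) (score_profile n sM) mu.
Proof.
move=> fg hW hM; have [mu mufg] := nat_perm fg.
exists mu => [w|]; first by case: (mufg w).
apply: (@unique_stable_ranked _ _ _ _ rho).
- move=> w m; rewrite /prefW !ffunE => lt; have le := rank_perm_le lt.
  have [[fw _] [_ gm]] := (mufg w, mufg m).
  have ne : m <> f w :> nat.
    by rewrite -fw => /val_inj e; move: lt; rewrite e ltnn.
  rewrite fw in le; have [] := hW w m (ltn_ord w) (ltn_ord m) ne le.
    by rewrite -gm; left.
  rewrite -gm => -[h1 h2]; right; split; first by rewrite /prefM !ffunE rank_perm_lt.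
  by move=> m' /eqP ne'; rewrite /prefW ?ffunE rank_perm_lt // h2 // => /val_inj.
- move=> m w; rewrite /prefM !ffunE => lt; have le := rank_perm_le lt.
  have [[fw _] [_ gm]] := (mufg w, mufg m).
  have ne : w <> g m :> nat.
    by rewrite -gm => /val_inj e; move: lt; rewrite e ltnn.
  rewrite gm in le; have [] := hM m w (ltn_ord m) (ltn_ord w) ne le.
    by rewrite -gm; left.
  rewrite -fw => -[h1 h2]; right; split; first by rewrite /prefW !ffunE rank_perm_lt.
  by move=> w' /eqP ne'; rewrite /prefM ?ffunE rank_perm_lt // h2 // => /val_inj.
Qed.

Ltac split_ifs := repeat match goal with
  | |- context [if ?b then _ else _] =>
      lazymatch b with context [if _ then _ else _] => fail | _ => case: (boolP b) => ? end
  end.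

(** * The market encoding two sets *)

Section Gadget.
Variables (L n : nat).
Hypotheses (L2n : (2 * L < n)%N).

(** Woman [2 * L] accepts any man below [L] in place of her own partner, and each later woman
    prefers the man of the preceding index: one man set free below [L] thus displaces the whole
    tail. *)
Definition women_score (X : nat -> nat -> bool) (w m : nat) : nat :=
  if (w < L)%N then
    if [&& L <= m, m < 2 * L & X w (m - L)]%N then 0 else if m == w then 1 else 2
  else if (w < 2 * L)%N then (m != w) : nat
  else if w == (2 * L)%N then if (m < L)%N then 0 else if m == w then 1 else 2
  else if m.+1 == w then 0 else if m == w then 1 else 2.

Definition men_score (Y : nat -> nat -> bool) (m w : nat) : nat :=
  if (m < L)%N then if w == m then 0 else if w == (2 * L)%N then 1 else 2
  else if (m < 2 * L)%N then
    if (w < L)%N && Y w (m - L)%N then 0 else if w == m then 1 else 2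
  else if w == m then 0 else if w == m.+1 then 1 else 2.

Lemma women_score_first X w m :
  (L <= w < 2 * L)%N -> m <> w -> (women_score X w w < women_score X w m)%N.
Proof. by move=> wL mw; rewrite /women_score; split_ifs; lia. Qed.

Lemma men_score_first Y m w :
  (m < L)%N -> w <> m -> (men_score Y m m < men_score Y m w)%N.
Proof. by move=> mL wm; rewrite /men_score; split_ifs; lia. Qed.

Lemma gadget_disjoint (X Y : nat -> nat -> bool) :
  (forall i j, X i j -> Y i j -> False) ->
  unique_stable (score_profile n (women_score X)) (score_profile n (men_score Y)) 1%g.
Proof.
move=> XY.
(* The rank is 0 below [2 * L] and then increases along the tail, where every better man of a woman
   has a wife of smaller rank. *)
have [|||mu muE us] := @unique_stable_score n (women_score X) (men_score Y) id id
  (fun w => w - (2 * L).-1)%N.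
- by [].
- move=> w m wn mn ne le; have [wL|wL] := ltnP w L; last first.
    by left; move: le; rewrite /women_score; split_ifs; lia.
  have /and3P[Lm m2L Xwm] : [&& L <= m, m < 2 * L & X w (m - L)]%N.
    by move: le; rewrite /women_score; split_ifs; lia.
  right; split; last by move=> m' _; apply: women_score_first; rewrite Lm.
  have /negP nY : ~ Y w (m - L)%N by apply: XY.
  by rewrite /men_score wL (negbTE nY); split_ifs; lia.
- move=> m w mn wn ne le; have [wL|wL] := ltnP w L; last first.
    by left; move: le; rewrite /men_score; split_ifs; lia.
  have /and3P[Lm m2L Ywm] : [&& L <= m, m < 2 * L & Y w (m - L)]%N.
    by move: le; rewrite /men_score; split_ifs; lia.
  right; split; last by move=> w' _; apply: men_score_first.
  have /negP nX : ~ X w (m - L)%N by move=> h; apply: XY h Ywm.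
  by rewrite /women_score wL (negbTE nX); split_ifs; lia.
suff -> : 1%g = mu by [].
by apply/permP => w; apply: val_inj; rewrite perm1 /= muE.
Qed.

Lemma gadget_meet (X Y : nat -> nat -> bool) (i0 j0 : nat) :
  (i0 < L)%N -> (j0 < L)%N -> X i0 j0 -> Y i0 j0 ->
  (forall i j, X i j -> Y i j -> i = i0 /\ j = j0) ->
  exists2 mu : marriage n,
    unique_stable (score_profile n (women_score X)) (score_profile n (men_score Y)) mu &
    forall w : 'I_n, mu w = w -> (w < 2 * L)%N /\ (w : nat) \notin [:: i0; (L + j0)%N].
Proof.
move=> i0L j0L Xij Yij XY.
(* The cycle of displacements: man [i0] moves to woman [2 * L], each man of the tail to the next
   woman, and the last man to woman [L + j0], whom her partner has left. *)
pose f w := (if w == i0 then L + j0 else if w == L + j0 then n.-1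
             else if w == 2 * L then i0 else if 2 * L < w then w.-1 else w)%N.
pose g m := (if m == L + j0 then i0 else if m == n.-1 then L + j0
             else if m == i0 then 2 * L else if 2 * L <= m then m.+1 else m)%N.
(* The order in which the couples are forced: the meeting point, the undisturbed couples, the tail
   in order, and finally woman [L + j0] with the leftover man. *)
pose rho w := (if w == i0 then 0 else if w == L + j0 then n.+2
               else if w < 2 * L then 1 else w.+2)%N.
have fg a : (a < n)%N -> [/\ (f a < n)%N, (g a < n)%N, g (f a) = a & f (g a) = a].
  by move=> an; split; rewrite /f /g; split_ifs; lia.
have [|||mu muE us] := @unique_stable_score n (women_score X) (men_score Y) f g rho.
- exact: fg.
- move=> w m wn mn ne le.
  have [lt|ge] := ltnP (rho (g m)) (rho w); [by left | right].
  (* The only temptation that the ranks do not settle is a man [L + j] with [j] other than [j0] and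
     [X w j]; as the sets meet only once, [Y w j] fails and he keeps his own partner. *)
  have /and5P[wL Lm m2L mj Xwm] :
      [&& w < L, L <= m, m < 2 * L, m != L + j0 & X w (m - L)]%N.
    move: ne le ge; have [->|wi] := eqVneq w i0.
      have -> : f i0 = (L + j0)%N by rewrite /f eqxx.
      have -> : women_score X i0 (L + j0) = 0%N.
        by rewrite /women_score i0L leq_addr addKn Xij andbT; split_ifs; lia.
      by move=> /eqP -> + _; rewrite i0L /women_score; split_ifs; lia.
    have [->|wj] := eqVneq w (L + j0)%N.
      move=> ne _; have : g m <> (L + j0)%N.
        by move=> e; have [_ _ _] := fg m mn; rewrite e; lia.
      by have [_ gn _ _] := fg m mn; rewrite /rho; split_ifs; lia.
    have [->|w2] := eqVneq w (2 * L)%N.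
      have -> : f (2 * L)%N = i0 by rewrite /f; split_ifs; lia.
      rewrite /women_score => ne le; have mL : (m < L)%N by move: le; split_ifs; lia.
      have -> : g m = m by rewrite /g; split_ifs; lia.
      by rewrite /rho; split_ifs; lia.
    have [w3|w3] := ltnP (2 * L) w.
      have -> : f w = w.-1 by rewrite /f; split_ifs; lia.
      by rewrite /women_score; split_ifs; lia.
    have -> : f w = w by rewrite /f; split_ifs; lia.
    have -> : rho w = 1%N by rewrite /rho; split_ifs; lia.
    have [->|mj] := eqVneq m (L + j0)%N.
      have -> : g (L + j0)%N = i0 by rewrite /g eqxx.
      by rewrite /rho eqxx.
    by move=> ne + _; rewrite /women_score; split_ifs; lia.
  have -> : g m = m by rewrite /g; split_ifs; lia.
  split; last by move=> m' _; apply: women_score_first; rewrite Lm.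
  have /negP nY : ~ Y w (m - L)%N by move=> h; have := XY _ _ Xwm h; lia.
  by rewrite /men_score wL (negbTE nY); split_ifs; lia.
- move=> m w mn wn ne le.
  have [lt|ge] := ltnP (rho w) (rho (g m)); [by left | right].
  have /and5P[wL Lm m2L wi Ywm] :
      [&& w < L, L <= m, m < 2 * L, w != i0 & Y w (m - L)]%N.
    move: ne le ge; have [->|mj] := eqVneq m (L + j0)%N.
      have -> : g (L + j0)%N = i0 by rewrite /g eqxx.
      have -> : men_score Y (L + j0) i0 = 0%N.
        by rewrite /men_score addKn Yij i0L; split_ifs; lia.
      by move=> /eqP -> + _; rewrite leq_addr /men_score; split_ifs; lia.
    have [->|m1] := eqVneq m n.-1.
      have -> : g n.-1 = (L + j0)%N by rewrite /g; split_ifs; lia.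
      by move=> ne _; rewrite /rho; split_ifs; lia.
    have [->|mi] := eqVneq m i0.
      have -> : g i0 = (2 * L)%N by rewrite /g; split_ifs; lia.
      move=> ne le; have -> : w = i0 by move: le; rewrite /men_score; split_ifs; lia.
      by rewrite /rho eqxx; split_ifs; lia.
    have [m2|m2] := leqP (2 * L) m.
      have -> : g m = m.+1 by rewrite /g; split_ifs; lia.
      move=> ne le; have -> : w = m by move: le; rewrite /men_score; split_ifs; lia.
      by rewrite /rho; split_ifs; lia.
    have -> : g m = m by rewrite /g; split_ifs; lia.
    have -> : rho m = 1%N by rewrite /rho; split_ifs; lia.
    have [->|wi] := eqVneq w i0; first by rewrite /rho eqxx.
    by move=> ne + _; rewrite /men_score; split_ifs; lia.
  have -> : f w = w by rewrite /f; split_ifs; lia.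
  split; last by move=> w' _; apply: men_score_first.
  have /negP nX : ~ X w (m - L)%N by move=> h; have := XY _ _ h Ywm; lia.
  by rewrite /women_score wL (negbTE nX); split_ifs; lia.
exists mu => // w mw; have := muE w; rewrite mw /f !inE; split_ifs; lia.
Qed.
End Gadget.

Definition grid L (x : {set 'I_L * 'I_L}) (i j : nat) : bool :=
  [exists p in x, (p.1 == i :> nat) && (p.2 == j :> nat)].

Lemma gridP L (x : {set 'I_L * 'I_L}) (i j : nat) :
  reflect (exists2 p, p \in x & (i, j) = (val p.1, val p.2)) (grid x i j).
Proof.
apply: (iffP exists_inP) => -[p px].
  by case/andP=> /eqP <- /eqP <-; exists p.
by case=> -> ->; exists p => //; rewrite !eqxx.
Qed.

Lemma grid_meet L (x y : {set 'I_L * 'I_L}) (i j : nat) :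
  grid x i j -> grid y i j -> exists2 p, p \in x :&: y & (i, j) = (val p.1, val p.2).
Proof.
case/gridP => p px e /gridP[q qy]; rewrite e => -[e1 e2].
exists p => //; rewrite inE px; suff -> : p = q by [].
by case: p q e1 e2 {px qy e} => [a b] [c d] /= /val_inj-> /val_inj->.
Qed.

Definition women_market L n (x : {set 'I_L * 'I_L}) : profile n :=
  score_profile n (women_score L (grid x)).
Definition men_market L n (y : {set 'I_L * 'I_L}) : profile n :=
  score_profile n (men_score L (grid y)).

Lemma market_disjoint L n (x y : {set 'I_L * 'I_L}) :
  (2 * L < n)%N -> x :&: y = set0 ->
  unique_stable (women_market n x) (men_market n y) 1%g.
Proof.
move=> L2n xy; apply: gadget_disjoint => // i j gx gy.
by have [p] := grid_meet gx gy; rewrite xy inE.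
Qed.

(** Women [p.1] and [L + p.2] are moved as well as the tail, whence the [- 2]. For [L = 1] no woman
    is fixed, so a one-point grid works for any positive gap. *)
Lemma market_meet L n (x y : {set 'I_L * 'I_L}) (p : 'I_L * 'I_L) :
  (2 * L < n)%N -> x :&: y = [set p] ->
  exists mu : marriage n,
    [/\ unique_stable (women_market n x) (men_market n y) mu,
        (#|[set w | mu w == w]| <= 2 * L - 2)%N
      & forall w : 'I_n, (2 * L <= w)%N -> mu w != w].
Proof.
move=> L2n xy.
have /setIP[px py] : p \in x :&: y by rewrite xy inE.
have [|||mu us fix_mu] := @gadget_meet L n L2n (grid x) (grid y) p.1 p.2
  (ltn_ord p.1) (ltn_ord p.2).
- by apply/gridP; exists p.
- by apply/gridP; exists p.
- move=> i j gx gy; have [q] := grid_meet gx gy.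
  by rewrite xy inE => /eqP-> [-> ->].
exists mu; split=> //; last first.
  by move=> w w2; apply/eqP => /fix_mu[]; lia.
have w1n : (p.1 < n)%N by have := ltn_ord p.1; lia.
have w2n : (L + p.2 < n)%N by have := ltn_ord p.2; lia.
have c2L : #|[set w : 'I_n | (w < 2 * L)%N]| = (2 * L)%N.
  rewrite -sum1dep_card -(big_ord_widen _ (fun=> 1%N) (ltnW L2n)).
  by rewrite sum1_card card_ord.
have : Ordinal w1n |: (Ordinal w2n |: [set w | mu w == w])
       \subset [set w : 'I_n | (w < 2 * L)%N].
  apply/subsetP => w; rewrite !inE => /or3P[/eqP->|/eqP->|/eqP/fix_mu[] //] /=.
    by have := ltn_ord p.1; lia.
  by have := ltn_ord p.2; lia.
move/subset_leq_card; rewrite c2L cardsU1 cardsU1 !inE.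
have -> : (Ordinal w1n == Ordinal w2n) = false.
  by apply/negP => /eqP [] /=; have := ltn_ord p.1; lia.
have -> : (mu (Ordinal w1n) == Ordinal w1n) = false.
  by apply/negP => /eqP /fix_mu [_]; rewrite !inE eqxx.
have -> : (mu (Ordinal w2n) == Ordinal w2n) = false.
  by apply/negP => /eqP /fix_mu [_]; rewrite !inE eqxx orbT.
by rewrite /= addnA => h; rewrite leq_subRL // (leq_trans _ h) // leq_addr.
Qed.

(** * From unique disjointness to query lower bounds *)

Section Prob.
Variables (R : realFieldType) (n : nat) (O : Type).
Implicit Types (A : seq (R * qtree n O)) (E F : qtree n O -> bool).

Lemma prob_le A E F : is_dist A -> (forall t, E t -> F t) -> prob A E <= prob A F.
Proof.
move=> /andP[A0 _] EF; rewrite /prob.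
elim: A A0 => [|[a t] A IH] /=; rewrite ?big_nil ?big_cons // => /andP[a0 A0].
rewrite lerD ?IH //=.
by have := EF t; case: (E t); case: (F t) => //= /(_ isT).
Qed.

Lemma prob_disjoint A E F : is_dist A -> (forall t, E t -> ~~ F t) ->
  prob A E + prob A F <= 1.
Proof.
move=> /andP[A0 /eqP <-] EF; rewrite /prob -big_split /=.
elim: A A0 => [|[a t] A IH] /=; rewrite ?big_nil ?big_cons // => /andP[a0 A0].
rewrite lerD ?IH //=.
by have := EF t; case: (E t); case: (F t) => /= h; rewrite ?addr0 ?add0r //; have := h isT.
Qed.

Lemma prob_eq A E F : is_dist A -> all (fun p => (0 < p.1) ==> (E p.2 == F p.2)) A ->
  prob A E = prob A F.
Proof.
move=> /andP[A0 _]; rewrite /prob.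
elim: A A0 => [|[a t] A IH] /=; rewrite ?big_nil ?big_cons // => /andP[a0 A0].
case/andP=> /implyP h /(IH A0) ->; congr (_ + _); move: a0; rewrite le_eqVlt.
by case/predU1P=> [<-|/h /eqP -> //]; do 2!case: ifP.
Qed.
End Prob.

Lemma run_queries0 n O (t : qtree n O) pW pM pW' pM' :
  queries t pW pM = 0%N -> run t pW' pM' = run t pW pM.
Proof. by case: t. Qed.

(** Half of [L * L], at least 20000, pays for 2800 * 7 = 19600; the other half pays for [2800 * q]
    with room to spare. *)
Lemma query_budget (L q : nat) :
  (200 <= L)%N -> (200 ^ 2 * q < L.+1 ^ 2)%N -> (q + 7 <= L * L %/ 2800)%N.
Proof.
move=> L200 qL; rewrite leq_divRL //.
have : (201 * 201 * (L * L) >= 200 * 200 * (L.+1 * L.+1))%N by nia.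
nia.
Qed.

(** The test [g] turns a valid output into an answer to unique disjointness: it tells the identity
    from a stable marriage with few fixed women. The clause on the last woman supplies a definite
    pair on which the two differ. *)
Lemma LowerBoundN2_of_gap (R : realFieldType) (I O : nat -> Type)
  (promise : forall n, I n -> profile n -> profile n -> bool)
  (valid : forall n, I n -> profile n -> profile n -> O n -> bool) (zeta : R) :
  0 < zeta -> zeta <= 1 / 2 ->
  (forall n, (2 < n)%N -> exists (i : I n) (g : O n -> bool), forall pW pM,
     (unique_stable pW pM 1%g ->
        promise n i pW pM /\ forall o, valid n i pW pM o -> g o) /\
     (forall mu, unique_stable pW pM mu ->
        #|[set w | mu w == w]|%:R < zeta * n%:R ->
        (forall w : 'I_n, w.+1 = n -> mu w != w) ->
        promise n i pW pM /\ forall o, valid n i pW pM o -> ~~ g o)) ->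
  LowerBoundN2 R I O promise valid.
Proof.
(* For the grid side [L] chosen below, [zeta * n < 2 * (L + 1)], so this constant keeps the number
   of queries under (L + 1)^2 / 200^2, as [query_budget] requires. *)
move=> z0 z12 gap; exists ((zeta / 400) ^+ 2); split.
  by rewrite exprn_gt0 // divr_gt0.
exists 3%N => n n3 A dA correct; have [i [g hg]] := gap n n3.
set c := (zeta / 400) ^+ 2.
have cn : c * (n ^ 2)%:R = (zeta * n%:R / 400) ^+ 2 by rewrite natrX /c -exprMn mulrAC.
case: (boolP [exists pW, exists pM,
    has (fun p => (0 < p.1) && (c * (n ^ 2)%:R <= (queries p.2 pW pM)%:R)) (A i)]).
  by case/existsP => pW /existsP[pM h]; exists i, pW, pM.
move=> few; exfalso.
have {}few pW pM :
    ~~ has (fun p => (0 < p.1) && (c * (n ^ 2)%:R <= (queries p.2 pW pM)%:R)) (A i).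
  by apply: contra few => h; apply/existsP; exists pW; apply/existsP; exists pM.
have n0 : 0 < n%:R :> R by rewrite ltr0n; lia.
have reduction L : (0 < L)%N -> (2 * L < n)%N -> (2 * L - 2)%:R < zeta * n%:R ->
  (forall x y : {set 'I_L * 'I_L}, x :&: y = set0 ->
   2 / 3 <= prob (A i) (fun t => g (run t (women_market n x) (men_market n y)))) /\
  (forall (x y : {set 'I_L * 'I_L}) p, x :&: y = [set p] ->
   prob (A i) (fun t => g (run t (women_market n x) (men_market n y))) <= 1 / 3).
  move=> L0 L2n Lz; split=> [x y|x y p] xy.
    have [/(_ (market_disjoint L2n xy))[pr va] _] :=
      hg (women_market n x) (men_market n y).
    by apply: le_trans (correct _ _ _ pr) _; apply: prob_le => // t /va.
  have [mu [us fix_mu last_mu]] := market_meet L2n xy.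
  have [_ /(_ mu us) []] := hg (women_market n x) (men_market n y).
  - by apply: le_lt_trans Lz; rewrite ler_nat.
  - by move=> w wn; apply: last_mu; lia.
  move=> pr va.
  have := prob_disjoint (E := fun t => valid n i (women_market n x) (men_market n y)
       (run t (women_market n x) (men_market n y)))
     (F := fun t => g (run t (women_market n x) (men_market n y))) (dA i)
     (fun t => va _).
  have := correct _ _ _ pr; lra.
(* [R] need not be archimedean: if [zeta] is infinitesimal this first case, in
   which one query meets the bound, covers every [n]. *)
have [cn1|cn1] := lerP (c * (n ^ 2)%:R) 1.
  have q0 pW pM : all (fun p => (0 < p.1) ==> (queries p.2 pW pM == 0%N)) (A i).
    rewrite -[all _ _]negbK -has_predC; apply: contra (few pW pM); apply: sub_has.
    move=> p /=; rewrite negb_imply -lt0n => /andP[-> q1] /=.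
    by apply: le_trans cn1 _; rewrite ler1n.
  have [||h0 h1] := @reduction 1%N isT; first by lia.
    by rewrite mulr_gt0.
  (* On a one-point grid, trees without queries answer alike for two empty sets and for two equal
     singletons, against the bounds 2/3 and 1/3. *)
  pose o := (ord0 : 'I_1, ord0 : 'I_1); pose e := set0 : {set 'I_1 * 'I_1}.
  have := h0 e e (setIid _); have := h1 [set o] [set o] o (setIid _).
  rewrite (@prob_eq _ _ _ _ _
    (fun t => g (run t (women_market n e) (men_market n e)))) //.
    by lra.
  apply: sub_all (q0 (women_market n [set o]) (men_market n [set o])) => p /=.
  by case: (0 < p.1) => //= /eqP/run_queries0 ->.
(* The largest such [L] exists because [zeta <= 1/2] bounds it by [n / 4], which also makes the
   gadget fit. *)
pose P L := ((2 * L)%:R <= zeta * n%:R).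
have P0 : exists L, P L by exists 0%N; rewrite /P mulr_ge0 // ltW.
have Pn L : P L -> (4 * L <= n)%N.
  rewrite /P -(ler_nat R) !natrM; nra.
have Pb L : P L -> (L <= n)%N by move/Pn; lia.
case: (ex_maxnP P0 Pb) => L PL maxL.
have {}maxL : zeta * n%:R < (2 * L.+1)%:R.
  by rewrite ltNge; apply/negP => /maxL; rewrite ltnn.
have zn : 400 < zeta * n%:R.
  rewrite ltNge; apply: contraTN cn1 => h; rewrite -leNgt cn exprn_ile1 //.
    by rewrite divr_ge0 // mulr_ge0 // ltW.
  by rewrite ler_pdivrMr // mul1r.
have L200 : (200 <= L)%N.
  have : (400 < 2 * L.+1)%N by rewrite -(ltr_nat R); apply: lt_trans zn maxL.
  by clear; lia.
have L0 : (0 < L)%N by apply: leq_trans L200.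
have [||h0 h1] := reduction L L0.
- by have := Pn L PL; clear -L0; lia.
- by apply: lt_le_trans PL; rewrite ltr_nat; clear -L0; lia.
pose cc := (L * L %/ 2800)%N.
have cc7 : (7 <= cc)%N by rewrite -[7%N]add0n query_budget.
suff: (cc < cc - 7 + 7)%N by rewrite subnK // ltnn.
apply: (@unique_disjointness_bound _ R n (O n) (@women_market L n) (@men_market L n) g
  (A i)) (dA i) _ h0 h1.
- by rewrite card_prod card_ord muln_gt0 L0.
- by rewrite card_prod card_ord mulnC leq_trunc_div.
- move=> x y; apply: contra (few (women_market n x) (men_market n y)).
  apply: sub_has => p /= /andP[-> ] /=; set q := queries _ _ _ => dq.
  rewrite leNgt; apply/negP => qc.
  have /(query_budget L200) qcc : (200 ^ 2 * q < L.+1 ^ 2)%N.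
    rewrite -(ltr_nat R) natrM !natrX -ltr_pdivlMl ?exprn_gt0 // mulrC -exprVn -exprMn.
    apply: lt_trans qc _; rewrite cn ltrXn2r // ?nnegrE ?divr_ge0 ?mulr_ge0 // 1?ltW //.
    by move: maxL; rewrite natrM; lra.
  by move: dq; rewrite ltn_subLR // addnC ltnNge qcc.
Qed.

(** * The six problems *)

Lemma in_some_unique n (pW pM : profile n) mu p :
  unique_stable pW pM mu -> in_some pW pM p = (mu p.1 == p.2).
Proof.
move=> us; apply/existsP/idP => [[nu]|h]; first by rewrite us => /andP[/eqP ->].
by exists mu; rewrite us eqxx.
Qed.

Lemma in_every_unique n (pW pM : profile n) mu p :
  unique_stable pW pM mu -> in_every pW pM p = (mu p.1 == p.2).
Proof.
move=> us; apply/forallP/idP => [/(_ mu)|h nu]; first by rewrite us eqxx.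
by rewrite us; apply/implyP => /eqP ->.
Qed.

(** The test asks whether all the pairs found are diagonal. In the meeting case the correct diagonal
    pairs are fixed women, fewer than half of the [eps * n] required. The graph of the stable
    marriage fulfils the promise. *)
Lemma LowerBoundN2_find_pairs (R : realFieldType) (eps : R)
  (Q : forall n, profile n -> profile n -> 'I_n * 'I_n -> bool) :
  0 < eps -> eps <= 1 ->
  (forall n (pW pM : profile n) mu p,
     unique_stable pW pM mu -> Q n pW pM p = (mu p.1 == p.2)) ->
  LowerBoundN2 R UnitI PairSet
    (fun n _ pW pM => [exists S : PairSet n,
       (eps * n%:R <= #|S|%:R) && [forall p in S, Q n pW pM p]])
    (fun n _ pW pM S => (eps * n%:R <= #|S|%:R) && [forall p in S, Q n pW pM p]).
Proof.
move=> e0 e1 QE; apply: (@LowerBoundN2_of_gap _ _ _ _ _ (eps / 2)); [lra|lra|].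
move=> n n2; exists tt, (fun S : PairSet n => [forall p in S, p.1 == p.2]) => pW pM.
have prom mu : unique_stable pW pM mu -> [exists S : PairSet n,
    (eps * n%:R <= #|S|%:R) && [forall p in S, Q n pW pM p]].
  move=> us; apply/existsP; exists [set (w, mu w) | w in [set: 'I_n]].
  rewrite card_imset => [|a b [] //]; rewrite cardsT card_ord ler_piMl //=.
  by apply/forall_inP => _ /imsetP[w _ ->]; rewrite (QE _ _ _ _ _ us) /=.
split=> [us|mu us fix_mu _]; split; try exact: prom us.
  move=> S /andP[_ /forall_inP h]; apply/forall_inP => p /h.
  by rewrite (QE _ _ _ _ _ us) perm1.
move=> S /andP[big /forall_inP h]; apply/negP => /forall_inP diag.
have : S \subset [set (w, w) | w in [set w | mu w == w]].
  apply/subsetP => -[w m] pS; have /eqP /= e := diag _ pS; rewrite -e in pS *.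
  by apply/imsetP; exists w => //; rewrite inE; have := h _ pS; rewrite (QE _ _ _ _ _ us).
move/subset_leq_card; rewrite card_imset => [|a b [] //]; rewrite -(ler_nat R).
have : 0 <= n%:R :> R by []; nra.
Qed.

Theorem theorem13 (R : realFieldType) :
  (* (a) finding a (1-eps)-stable marriage, 0 <= eps < 1/2 *)
  (forall eps : R, 0 <= eps -> eps < 2%:R^-1 ->
     LowerBoundN2 R UnitI marriage
       (fun n _ pW pM => true)
       (fun n _ pW pM mu => almost_stable eps pW pM mu)) /\
  (* (b) stable vs eps-unstable promise problem, 0 <= eps < 1 *)
  (forall eps : R, 0 <= eps -> eps < 1 ->
     LowerBoundN2 R marriage (fun _ => bool)
       (fun n mu pW pM => stable pW pM mu || eps_unstable eps pW pM mu)
       (fun n mu pW pM b => b == stable pW pM mu)) /\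
  (* (c) is (w,m) in some stable marriage *)
  LowerBoundN2 R Pair (fun _ => bool)
       (fun n _ pW pM => true)
       (fun n p pW pM b => b == in_some pW pM p) /\
  (* (c) is (w,m) in every stable marriage *)
  LowerBoundN2 R Pair (fun _ => bool)
       (fun n _ pW pM => true)
       (fun n p pW pM b => b == in_every pW pM p) /\
  (* (d) finding eps n pairs each in some stable marriage, 0 < eps <= 1 *)
  (forall eps : R, 0 < eps -> eps <= 1 ->
     LowerBoundN2 R UnitI PairSet
       (fun n _ pW pM => [exists S : PairSet n,
           (eps * n%:R <= #|S|%:R) && [forall p in S, in_some pW pM p]])
       (fun n _ pW pM S =>
           (eps * n%:R <= #|S|%:R) && [forall p in S, in_some pW pM p])) /\
  (* (d) finding eps n pairs each in every stable marriage, 0 < eps <= 1 *)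
  (forall eps : R, 0 < eps -> eps <= 1 ->
     LowerBoundN2 R UnitI PairSet
       (fun n _ pW pM => [exists S : PairSet n,
           (eps * n%:R <= #|S|%:R) && [forall p in S, in_every pW pM p]])
       (fun n _ pW pM S =>
           (eps * n%:R <= #|S|%:R) && [forall p in S, in_every pW pM p])).
Proof.
have ddistE n (mu nu : marriage n) :
    (ddist mu nu)%:R = n%:R - #|[set w | mu w == nu w]|%:R :> R.
  by rewrite /ddist natrB // -[X in (_ <= X)%N]card_ord max_card.
split; [|split; [|split; [|split; [|split]]]].
- move=> eps e0 e1; have {}e1 : eps < 1 / 2 by rewrite mul1r.
  (* An output within [eps * n] of both the identity and [mu] agrees with each on at least
     [(1 - eps) * n] women, so these two agree on at least [(1 - 2 * eps) * n], twice the gap. *)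
  apply: (@LowerBoundN2_of_gap _ _ _ _ _ ((1 - 2 * eps) / 2)); [lra|lra|].
  move=> n n2; exists tt, (fun mu => (ddist mu 1%g)%:R <= eps * n%:R) => pW pM.
  split=> [us|mu us fix_mu _]; split=> // o /existsP[nu]; rewrite us => /andP[/eqP -> //].
  rewrite !ddistE => near; rewrite -ltNge.
  set P := [set w | o w == (1%g : marriage n) w]; set M := [set w | o w == mu w] in near.
  have : (#|P| + #|M| <= n + #|[set w | mu w == w]|)%N.
    rewrite -cardsUI leq_add //; first by rewrite -[X in (_ <= X)%N]card_ord max_card.
    apply/subset_leq_card/subsetP => w; rewrite !inE perm1.
    by case/andP => ow /eqP <-.
  rewrite -(ler_nat R) !natrD; move: fix_mu near.
  have : 0 <= (1 - 2 * eps) * n%:R by rewrite mulr_ge0 //; lra.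
  set a := #|P|%:R; set b := #|M|%:R; set c := #|_|%:R; lra.
(* The given marriage is the identity. With fewer than [(1 - eps) / 2 * n] fixed women, its distance
   from [mu] exceeds [(1 + eps) / 2 * n], hence [eps * n]. *)
- move=> eps e0 e1; apply: (@LowerBoundN2_of_gap _ _ _ _ _ ((1 - eps) / 2)); [lra|lra|].
  move=> [//|n] n2; exists 1%g, id => pW pM.
  split=> [us|mu us fix_mu last_mu].
    by rewrite us eqxx; split=> // o /eqP ->.
  have ne : (1%g == mu) = false.
    by apply/negP => /eqP e; have := last_mu ord_max erefl; rewrite -e perm1 eqxx.
  split; last by move=> o; rewrite us ne => /eqP ->.
  apply/orP; right; apply/forallP => nu; rewrite us; apply/implyP => /eqP ->.
  rewrite ddistE; have -> : [set w | (1%g : marriage n.+1) w == mu w] = [set w | mu w == w].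
    by apply/setP => w; rewrite !inE perm1 eq_sym.
  have : 0 <= n.+1%:R :> R by []; nra.
- apply: (@LowerBoundN2_of_gap _ _ _ _ _ (1 / 2)); [lra|lra|].
  (* The queried pair is the last couple, married under the identity and separated by every [mu] of
     the meeting case. *)
  move=> [//|n] n2; exists (ord_max, ord_max), id => pW pM.
  split=> [us|mu us _ last_mu]; split=> // o; rewrite (in_some_unique _ us) => /eqP ->.
    by rewrite perm1.
  exact: last_mu.
- apply: (@LowerBoundN2_of_gap _ _ _ _ _ (1 / 2)); [lra|lra|].
  move=> [//|n] n2; exists (ord_max, ord_max), id => pW pM.
  split=> [us|mu us _ last_mu]; split=> // o; rewrite (in_every_unique _ us) => /eqP ->.
    by rewrite perm1.
  exact: last_mu.
- by move=> eps e0 e1; apply: LowerBoundN2_find_pairs => // *; apply: in_some_unique.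
- by move=> eps e0 e1; apply: LowerBoundN2_find_pairs => // *; apply: in_every_unique.
Qed.
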